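(* Let $\nu=2^{2m}\mu$, where $m\ge 1$ is an integer and $\mu\ge 3$ is an odd integer such that, for every Fermat prime $p>3$, $\mu$ is not a square modulo $p$. Then either $4<\mathrm{JR}(\mathcal{O}^{\nu})<+\infty$, or $\mathrm{JR}(\mathcal{O}^{\nu})=4$ and $4\notin A(\mathcal{O}^{\nu})$ (that is, the $\mathrm{JR}$ number is $4$ and it is not a minimum).
   Context: A Fermat prime is a prime of the form $2^{2^k}+1$ with $k\ge 0$. ''Not a square modulo $p$'' means not congruent to any integer square modulo $p$; in particular $p$ does not divide the number. For a non-square integer $\nu\ge 4$, let $x_1=\sqrt{\nu}$ and $x_{n+1}=\sqrt{\nu+x_n}$ for $n\ge 1$ (positive real square roots), and $K_n=\mathbb{Q}(x_n)$. The fields $K_n$ are totally real and form an increasing tower. Let $\mathcal{O}^{\nu}=\bigcup_{n\ge1}\mathcal{O}_{K_n}$, where $\mathcal{O}_{K_n}$ is the ring of integers of $K_n$. For a ring $R$ of totally real algebraic integers, and $t\in\mathbb{R}\cup\{+\infty\}$, write $0\ll r\ll t$ if every conjugate of $r$ over $\mathbb{Q}$ lies strictly between $0$ and $t$, and let $$A(R)=\{t\in\mathbb{R}\cup\{+\infty\} : \text{there are infinitely many } r\in R \text{ such that } 0\ll r\ll t\}.$$ For $R=\mathcal{O}^{\nu}$ (the ring of integers of $\bigcup_n K_n$), the set $A(R)$ is either $\{+\infty\}$, or consists of all $t\in\mathbb{R}\cup\{+\infty\}$ with $t\ge\lambda$, or of all $t\in\mathbb{R}\cup\{+\infty\}$ with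 $t>\lambda$, for some real $\lambda\ge 4$. The number $\mathrm{JR}(R)$ is $+\infty$ in the first case and $\lambda$ in the other cases, i.e. $\mathrm{JR}(R)=\inf A(R)$. *)

(* Defs.v *)
From HB Require Import structures.
From mathcomp Require Import all_boot all_order all_algebra.
From mathcomp Require Import all_classical all_reals all_analysis.
From mathcomp Require Import complex.

Set Implicit Arguments.
Unset Strict Implicit.
Unset Printing Implicit Defensive.

Import Order.TTheory GRing.Theory Num.Theory.

Local Open Scope classical_set_scope.
Local Open Scope ring_scope.
Local Open Scope complex_scope.

Definition fermat_prime (p : nat) : Prop :=
  prime p /\ exists k : nat, p = (2 ^ (2 ^ k) + 1)%N.

Definition square_mod (p a : nat) : Prop :=
  exists b : int, (b ^+ 2 = a%:Z %[mod p%:Z])%Z.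

(* Indices are shifted by one: [x_seq R nu n] is x_{n+1}, so that
   [x_seq R nu 0] is x_1 = sqrt nu. *)
Fixpoint x_seq (R : realType) (nu n : nat) : R :=
  if n is n'.+1 then Num.sqrt (nu%:R + x_seq R nu n') else Num.sqrt nu%:R.

(* The subfield Q(x) of R.  A set closed under [divring_closed] is a subfield,
   and it contains Q because R has characteristic 0. *)
Definition Qadjoin (R : realType) (x : R) : set R :=
  smallest (fun K : set R => divring_closed (mem K)) [set x].

Definition ring_of_integers (R : realType) (K : set R) : set R :=
  [set y | K y /\ integralOver (intr : int -> R) y].

Definition O_tower (R : realType) (nu : nat) : set R :=
  \bigcup_n ring_of_integers (Qadjoin (x_seq R nu n)).
Arguments O_tower R nu : clear implicits.

Definition is_minpolyQ (R : realType) (p : {poly rat}) (r : R) : Prop :=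
  [/\ p \is monic, irreducible_poly p & root (map_poly ratr p) r].

Definition conjugateQ (R : realType) (r : R) (z : R[i]) : Prop :=
  exists p : {poly rat},
    is_minpolyQ p r /\ root (map_poly (ratr : rat -> R[i]) p) z.

(* 0 << r << t.  A number without a minimal polynomial over Q has no conjugate
   in this sense; the predicate is meant for algebraic r only. *)
Definition totally_between (R : realType) (r : R) (t : \bar R) : Prop :=
  forall z : R[i], conjugateQ r z ->
    exists s : R, z = s%:C /\ (0%:E < s%:E < t)%E.

(* -oo is excluded since t ranges over the reals and +oo only. *)
Definition A_set (R : realType) (S : set R) : set (\bar R) :=
  [set t | t != -oo%E /\ infinite_set [set r | S r /\ totally_between r t]].

Definition JR (R : realType) (S : set R) : \bar R := ereal_inf (A_set S).

(* Main.v *)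
Require Import Defs.
From mathcomp Require Import all_boot all_order all_algebra all_field.
From mathcomp Require Import all_classical all_reals all_analysis.
From mathcomp Require Import complex ring lra zify.

(** The set [A_set S] is upward closed, so once it is known that 4 is not in
    [A_set (O_tower R nu)], every element of that set exceeds 4 and the
    infimum is at least 4; whether it equals 4 or exceeds 4, the conclusion
    follows as soon as the infimum is finite.  Finiteness is easy
    ([JR_lty]): all conjugates of [x_seq R nu n] are real and bounded by
    [nu], so the infinitely many numbers [x_seq R nu n + nu + 1] have all
    their conjugates between 0 and [2 * nu + 2].

    That 4 is not in the set ([A_set_not4]) means that only finitely many r in
    the ring have all their conjugates strictly between 0 and 4.  By a theorem
    of Kronecker ([kronecker]) such an r is [2 + z + z^-1] for a root of unity
    z, say of order N, and it is enough to prove that N divides 12.  Let K be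
    the union of the fields in the tower; it contains every
    [z ^+ k + z ^- k].
    - The field K(z) is a union of number fields whose degrees are powers of
      2, so any power of z has degree a power of 2 over Q.  This degree is the
      totient of its order ([totient_dvd_pow2]), which rules out 9 | N and
      shows that a prime p > 3 dividing N is a Fermat prime.
    - If 8 | N then K contains the square root of 2, and if a prime p = 1 mod
      4 divides N then K contains the square root of p, which is a product of
      differences [z ^+ k - z ^- k] ([sqrt2_of_root8],
      [sqrt_prime_of_root]).
    - On the other hand a natural number d with a square root in K must be a
      square, or become one after multiplication by [nu] ([tower_sqrt]).
      Indeed the only quadratic subfield of K is Q(sqrt nu): a new one,
      appearing when the square root of [nu + x_seq R nu n] is adjoined, would
      make a rational multiple of that number a square, and taking norms down
      to Q would turn the value at 0 of an iterate of X^2 - nu into a rational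
      square.  That value is nu times an integer coprime to nu, and nu is
      not a square, since mu is not one modulo 5.
    When d is 2 or a Fermat prime greater than 3, neither d nor [d * nu] is a
    square: the exponent of d in [nu = 2 ^ (2 * m) * mu] is even, because mu is
    odd and is not divisible by a Fermat prime d > 3, 0 being a square
    modulo d. *)

Set Implicit Arguments.
Unset Strict Implicit.
Unset Printing Implicit Defensive.

Import Order.TTheory GRing.Theory Num.Theory.

Local Open Scope classical_set_scope.
Local Open Scope ring_scope.
Local Open Scope complex_scope.

Local Notation pZtoQ := (map_poly (intr : int -> rat)).

(** * Subfields of the reals and adjunction of square roots *)

Section Subfields.
Variable R : realType.
Implicit Types (K : set R) (x y : R).

(** The closure conditions of [divring_closed], restated with [K] as a
    predicate so that they can be applied without going through [mem]. *)
Definition is_subfield K :=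
  [/\ K 1, forall x y, K x -> K y -> K (x - y) & forall x y, K x -> K y -> K (x / y)].

Lemma is_subfieldP K : divring_closed (mem K) <-> is_subfield K.
Proof.
split=> -[K1 KB KV]; split.
- by move: K1; rewrite inE.
- by move=> x y Kx Ky; have := KB x y; rewrite !inE; apply.
- by move=> x y Kx Ky; have := KV x y; rewrite !inE; apply.
- by rewrite inE.
- by move=> x y; rewrite !inE; apply: KB.
- by move=> x y; rewrite !inE; apply: KV.
Qed.

Lemma subfield0 K : is_subfield K -> K 0.
Proof. by move=> [K1 KB KV]; rewrite -(subrr 1); apply: KB. Qed.

Lemma subfieldN K x : is_subfield K -> K x -> K (- x).
Proof. by move=> hK Kx; rewrite -sub0r; case: (hK) => _ + _; apply => //; exact: subfield0. Qed.

Lemma subfieldB K x y : is_subfield K -> K x -> K y -> K (x - y).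
Proof. by case=> _ + _; apply. Qed.

Lemma subfieldD K x y : is_subfield K -> K x -> K y -> K (x + y).
Proof. by move=> hK Kx Ky; rewrite -[y]opprK; apply: subfieldB => //; exact: subfieldN. Qed.

Lemma subfieldV K x : is_subfield K -> K x -> K x^-1.
Proof. by move=> [K1 KB KV] Kx; rewrite -div1r; apply: KV. Qed.

Lemma subfieldM K x y : is_subfield K -> K x -> K y -> K (x * y).
Proof. by move=> hK Kx Ky; rewrite -[y]invrK; case: (hK) => _ _; apply => //; exact: subfieldV. Qed.

Lemma subfield_nat K n : is_subfield K -> K n%:R.
Proof.
move=> hK; elim: n => [|n IHn]; first exact: subfield0.
by rewrite -natr1; apply: subfieldD => //; case: hK.
Qed.

Lemma subfield_int K (i : int) : is_subfield K -> K i%:~R.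
Proof.
move=> hK; case: i => n; first exact: subfield_nat.
by rewrite NegzE mulrNz; apply: subfieldN => //; exact: subfield_nat.
Qed.

Lemma subfield_horner K (p : {poly int}) x :
  is_subfield K -> K x -> K (map_poly intr p).[x].
Proof.
move=> hK Kx; elim/poly_ind: p => [|p c IHp].
  by rewrite map_poly0 horner0; exact: subfield0.
rewrite rmorphD rmorphM /= map_polyX map_polyC !hornerE.
by apply: subfieldD => //; [exact: subfieldM | exact: subfield_int].
Qed.

Lemma subfield_range_ratr : is_subfield (range (ratr : rat -> R)).
Proof.
split; first by exists 1; rewrite ?rmorph1.
  by move=> _ _ [a _ <-] [b _ <-]; exists (a - b); rewrite // rmorphB.
by move=> _ _ [a _ <-] [b _ <-]; exists (a / b); rewrite // fmorph_div.
Qed.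

(** When [x ^+ 2] lies in [K] this is the field K(x). *)
Definition adjoin K x : set R := [set u + v * x | u in K & v in K].

Lemma sub_adjoin K x : is_subfield K -> K `<=` adjoin K x.
Proof. by move=> hK u Ku; exists u => //; exists 0; [exact: subfield0|rewrite mul0r addr0]. Qed.

Lemma mem_adjoin K x : is_subfield K -> adjoin K x x.
Proof.
move=> hK; exists 0; first exact: subfield0.
by exists 1; [case: hK | rewrite mul1r add0r].
Qed.

Lemma adjoin_idem K x : is_subfield K -> K x -> adjoin K x = K.
Proof.
move=> hK Kx; apply/seteqP; split; last exact: sub_adjoin.
by move=> _ [u Ku [v Kv <-]]; apply: subfieldD => //; exact: subfieldM.
Qed.

Lemma adjoin_inj K x u v u' v' : is_subfield K -> ~ K x ->
  K u -> K v -> K u' -> K v' -> u + v * x = u' + v' * x -> u = u' /\ v = v'.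
Proof.
move=> hK Kx Ku Kv Ku' Kv' e.
have [vv|nvv] := eqVneq v v'; first by subst v'; split=> //; exact: addIr e.
exfalso; apply: Kx; have -> : x = (u' - u) / (v - v').
  have v0 : v - v' != 0 by rewrite subr_eq0.
  apply: (mulIf v0); rewrite divfK //.
  have -> : u' = u + v * x - v' * x by rewrite e addrK.
  by ring.
by case: (hK) => _ _; apply; exact: subfieldB.
Qed.

(** Inverses come from the conjugate: [(u + v x)^-1] is [(u - v x) / D] with
    D the norm [u^2 - v^2 x^2], which vanishes only with [u + v x] unless [x]
    is already in [K]. *)
Lemma subfield_adjoin K x : is_subfield K -> K (x ^+ 2) -> is_subfield (adjoin K x).
Proof.
move=> hK Kx2; have [Kx|nKx] := pselect (K x); first by rewrite adjoin_idem.
have hB : forall a b, adjoin K x a -> adjoin K x b -> adjoin K x (a - b).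
  move=> _ _ [u Ku [v Kv <-]] [w Kw [t Kt <-]].
  exists (u - w); first exact: subfieldB.
  by exists (v - t); [exact: subfieldB | ring].
have hM : forall a b, adjoin K x a -> adjoin K x b -> adjoin K x (a * b).
  move=> _ _ [u Ku [v Kv <-]] [w Kw [t Kt <-]].
  exists (u * w + v * t * x ^+ 2).
    by apply: subfieldD => //; apply: subfieldM => //; exact: subfieldM.
  by exists (u * t + v * w); [apply: subfieldD => //; exact: subfieldM | ring].
split=> //; first by apply: sub_adjoin => //; case: hK.
move=> a b Ka Kb; apply: hM => //; case: Kb => u Ku [v Kv <-].
have [->|nz] := eqVneq (u + v * x) 0.
  by rewrite invr0; apply: sub_adjoin => //; exact: subfield0.
pose D := u ^+ 2 - v ^+ 2 * x ^+ 2.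
have KD : K D.
  rewrite /D !expr2; apply: subfieldB => //; apply: subfieldM => //;
    by [exact: subfieldM | rewrite -expr2].
have D0 : D != 0.
  have -> : D = (u + v * x) * (u - v * x) by rewrite /D; ring.
  rewrite mulf_neq0 //; apply: contraNneq nz => e.
  have [v0|v0] := eqVneq v 0.
    by move: e; rewrite v0 mul0r subr0 addr0 => ->.
  exfalso; apply: nKx; have -> : x = u / v.
    apply: (mulIf v0); rewrite divfK // mulrC.
    by apply/eqP; rewrite -subr_eq0 -oppr_eq0 opprB e.
  by case: (hK) => _ _; apply.
exists (u / D); first by case: (hK) => _ _; apply.
exists (- v / D); first by case: (hK) => _ _; apply => //; exact: subfieldN.
apply: (mulIf nz); rewrite mulVf //.
have -> : (u / D + - v / D * x) * (u + v * x) = D / D by rewrite /D; ring.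
by rewrite divff.
Qed.

(** Squares have square norms: the norm of [e * (c + x)] from K(x) to [K] is
    [e ^+ 2 * (c ^+ 2 - x ^+ 2)].  The proof works with the coordinates of [w]
    instead of introducing the conjugation of K(x). *)
Lemma adjoin_norm_square K x e c w : is_subfield K -> K (x ^+ 2) -> ~ K x -> K c -> K e -> e != 0 ->
  adjoin K x w -> w ^+ 2 = e * (c + x) -> exists2 y, K y & y ^+ 2 = c ^+ 2 - x ^+ 2.
Proof.
move=> hK Kx2 nKx Kc Ke e0 [u Ku [v Kv <-]] Hw.
have KM a b : K a -> K b -> K (a * b) by apply: subfieldM.
have KD a b : K a -> K b -> K (a + b) by apply: subfieldD.
have [] := @adjoin_inj K x (u * u + v * v * x ^+ 2) (u * v + u * v) (e * c) e hK nKx; auto.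
  by rewrite -[RHS]mulrDr -Hw; ring.
move=> h1 h2; exists ((u * u - v * v * x ^+ 2) / e).
  case: (hK) => _ _; apply => //; apply: subfieldB; auto.
apply: (mulIf (expf_neq0 2 e0)); rewrite -exprMn divfK //.
have -> : (c ^+ 2 - x ^+ 2) * e ^+ 2 = (e * c) ^+ 2 - e ^+ 2 * x ^+ 2 by ring.
by rewrite -h1 -h2; ring.
Qed.

End Subfields.

(** * The orbit of nu under squaring and subtracting nu contains no square *)

Lemma rat_sqr_int (q : rat) (z : int) : q ^+ 2 = z%:~R -> exists k : nat, z = (k ^ 2)%N.
Proof.
move=> Hq; have d0 : (denq q)%:~R != 0 :> rat by rewrite intr_eq0 denq_eq0.
have {Hq} e : (numq q ^+ 2 = z * denq q ^+ 2)%R.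
  apply/eqP; rewrite -(eqr_int rat) intrM !rmorphXn /= -Hq -exprMn.
  by rewrite numqE.
have dn : (`|denq q| %| `|numq q|)%N.
  by rewrite -(@dvdn_pexp2r _ _ 2) // -!abszX e abszM dvdn_mull.
have d1 : `|denq q|%N = 1%N.
  by apply/eqP; rewrite -dvdn1 -(eqP (coprime_num_den q)) dvdn_gcd dn dvdnn.
have {}d1 : denq q = 1 by rewrite -(gez0_abs (denq_ge0 q)) d1.
by exists `|numq q|%N; rewrite -abszX -[z]mulr1 -(expr1n _ 2) -d1 -e gez0_abs ?sqr_ge0.
Qed.

(** Here [a] is the square of [gcdn a k]. *)
Lemma square_of_coprime_mul (a b k : nat) : coprime a b -> (a * b = k ^ 2)%N ->
  exists g : nat, a = (g ^ 2)%N.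
Proof.
move=> cab e; have [k0|k0] := posnP k.
  subst k; move: e cab; rewrite -(muln0 0%N) => /eqP; rewrite muln0 exp0n // muln_eq0.
  move=> /orP[] /eqP ->; first by exists 0%N.
  by rewrite /coprime gcdn0 => /eqP ->; exists 1%N.
pose g := gcdn a k; have g0 : (0 < g)%N by rewrite gcdn_gt0 k0 orbT.
have [a' Da] : exists a', a = (a' * g)%N by apply/dvdnP; exact: dvdn_gcdl.
have [k' Dk] : exists k', k = (k' * g)%N by apply/dvdnP; exact: dvdn_gcdr.
have cak : coprime a' k'.
  rewrite /coprime -(eqn_pmul2r g0) muln_gcdl -Da -Dk mul1n; exact: eqxx.
have {e} e : (a' * b = g * k' ^ 2)%N.
  apply/eqP; rewrite -(eqn_pmul2r g0) mulnAC -Da e Dk expnMn; apply/eqP; ring.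
exists g; rewrite Da expnS expn1; congr (_ * _)%N; apply/eqP; rewrite eqn_dvd.
apply/andP; split.
  by rewrite -(@Gauss_dvdl a' g (k' ^ 2)) ?coprimeXr // -e dvdn_mulr.
rewrite -(@Gauss_dvdl g a' b) ?e ?dvdn_mulr //.
by apply: coprime_dvdl cab; rewrite Da dvdn_mull.
Qed.

(** Up to sign, taking the norm of [c + x_seq R nu n] one level down the tower
    applies this map to [c]. *)
Definition sqstep (nu : nat) (c : int) : int := c ^+ 2 - nu%:Z.

(** Every term of the orbit is [nu * b] for an integer b, and the next one is
    [nu * (nu * b ^ 2 - 1)], a product of coprime factors; were it a square,
    [nu] would be one too. *)
Lemma iter_sqstep_nsquare (nu n : nat) (q : rat) :
  (forall k, nu <> (k ^ 2)%N) -> q ^+ 2 = (iter n.+1 (sqstep nu) nu%:Z)%:~R -> False.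
Proof.
move=> nsq /rat_sqr_int[k]; rewrite iterS.
have [b ->] : exists b : int, iter n (sqstep nu) nu%:Z = nu%:Z * b.
  elim: n => [|n [b IHn]]; first by exists 1; rewrite mulr1.
  by exists (nu%:Z * b ^+ 2 - 1); rewrite iterS IHn /sqstep; ring.
rewrite /sqstep => e.
have nu0 : (0 < nu)%N by rewrite lt0n; apply/eqP => e0; apply: (nsq 0%N); rewrite e0.
have [b0|b0] := eqVneq b 0.
  by move: e; rewrite b0 mulr0 expr0n /= sub0r; lia.
have c0 : (0 < nu * `|b| ^ 2)%N by rewrite muln_gt0 nu0 expn_gt0 absz_gt0 b0.
have [||g Hg] := @square_of_coprime_mul nu (nu * `|b| ^ 2).-1 k; last exact: (nsq g).
  rewrite coprime_sym; apply: (@coprime_dvdr _ (nu * `|b| ^ 2)); first exact: dvdn_mulr.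
  by rewrite coprimePn.
have bb : b ^+ 2 = (`|b| ^ 2)%N by rewrite -abszX gez0_abs ?sqr_ge0.
move: e c0; rewrite exprMn bb; move: (`|b| ^ 2)%N => B; nia.
Qed.

(** * Square roots of integers in the tower *)

Section Tower.
Variables (R : realType) (nu : nat).
Hypothesis nu_nsq : forall k, nu <> (k ^ 2)%N.

Local Notation x := (x_seq R nu).

Fixpoint tower n : set R :=
  if n is n'.+1 then adjoin (tower n') (x n') else range (ratr : rat -> R).

Lemma x_seq_ge0 n : 0 <= x n.
Proof. by case: n => [|n]; exact: sqrtr_ge0. Qed.

Lemma x_seq0_sqr : x 0 ^+ 2 = nu%:R.
Proof. by rewrite sqr_sqrtr // ler0n. Qed.

Lemma x_seqS_sqr n : x n.+1 ^+ 2 = nu%:R + x n.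
Proof. by rewrite sqr_sqrtr // addr_ge0 ?ler0n ?x_seq_ge0. Qed.

Lemma tower_spec n : is_subfield (tower n) /\ tower n (x n ^+ 2).
Proof.
elim: n => [|n [IH1 IH2]].
  have H := subfield_range_ratr R.
  by split=> //; rewrite x_seq0_sqr; exact: subfield_nat.
have H : is_subfield (tower n.+1) by exact: subfield_adjoin.
split=> //; rewrite x_seqS_sqr; apply: subfieldD => //; first exact: subfield_nat.
exact: mem_adjoin.
Qed.

Lemma subfield_tower n : is_subfield (tower n). Proof. by case: (tower_spec n). Qed.

Lemma tower_sqr n : tower n (x n ^+ 2). Proof. by case: (tower_spec n). Qed.
Hint Resolve subfield_tower tower_sqr : core.

Lemma mem_tower n : tower n.+1 (x n).
Proof. exact: mem_adjoin. Qed.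

Lemma Qadjoin_sub_tower n : Qadjoin (x n) `<=` tower n.+1.
Proof.
move=> y; apply; split; first by apply/is_subfieldP.
by move=> _ ->; exact: mem_tower.
Qed.

(** Iterated norms: the norm of [e * (c + x n)] to [tower n] shows that
    [c ^+ 2 - nu - x n.-1] is a square there, which has the same shape with
    [-1] and [- sqstep nu c] in place of [e] and [c].  Since [sqstep] is even,
    the sign is harmless at the next step. *)
Lemma tower_norm_square n (c e : int) w :
  (forall j, (j <= n)%N -> ~ tower j (x j)) -> e != 0 ->
  tower n.+1 w -> w ^+ 2 = e%:~R * (c%:~R + x n) ->
  exists q : rat, q ^+ 2 = (iter n.+1 (sqstep nu) c)%:~R.
Proof.
elim: n c e w => [|n IHn] c e w nx e0 Kw Hw.
  have [||||||y [q _ <-]] := @adjoin_norm_square _ (tower 0) (x 0) e%:~R c%:~R w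
    _ _ _ _ _ _ Kw Hw; auto.
  - exact: subfield_int.
  - exact: subfield_int.
  - by rewrite intr_eq0.
  rewrite x_seq0_sqr => Hq; exists q.
  apply: (fmorph_inj (ratr : rat -> R)); rewrite rmorphXn /= Hq rmorph_int.
  by rewrite /sqstep intrB !rmorphXn.
have [||||||y Ky Hy] := @adjoin_norm_square _ (tower n.+1) (x n.+1) e%:~R c%:~R w
    _ _ _ _ _ _ Kw Hw; auto.
- exact: subfield_int.
- exact: subfield_int.
- by rewrite intr_eq0.
have [|||q Hq] := IHn (- sqstep nu c) (- 1) y _ _ Ky; rewrite ?oppr_eq0 //.
  by move=> j jn; apply: nx; apply: leqW.
  rewrite Hy x_seqS_sqr /sqstep mulrNz intrB rmorphXn /= rmorphN1.
  by ring.
exists q; rewrite Hq; congr (_%:~R); rewrite !iterSr; congr (iter _ _ _).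
by rewrite /sqstep sqrrN.
Qed.

(** Each step of the tower has degree exactly 2: otherwise [nu + x n] would be
    a square one level below, and [tower_norm_square] would produce a square
    in the orbit of [nu]. *)
Lemma x_seq_notin_tower n : ~ tower n (x n).
Proof.
elim/ltn_ind: n => [[|n]] IHn.
  move=> [q _ Hq]; have : q ^+ 2 = (Posz nu)%:~R.
    by apply: (fmorph_inj (ratr : rat -> R)); rewrite rmorphXn /= Hq x_seq0_sqr rmorph_int.
  by move=> /rat_sqr_int[k [/nu_nsq]].
move=> Kx; have [|||q Hq] := @tower_norm_square n nu 1 (x n.+1) _ _ Kx; auto.
  by rewrite x_seqS_sqr mul1r.
exact: iter_sqstep_nsquare Hq.
Qed.

Lemma tower_coef n (d : nat) u v : tower n u -> tower n v ->
  (u + v * x n) ^+ 2 = d%:R -> u ^+ 2 + v ^+ 2 * x n ^+ 2 = d%:R /\ u * v = 0.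
Proof.
move=> Ku Kv Hw.
have KM a b : tower n a -> tower n b -> tower n (a * b) by exact: subfieldM.
have [|||||||] := @adjoin_inj _ (tower n) (x n) (u ^+ 2 + v ^+ 2 * x n ^+ 2)
  (u * v *+ 2) d%:R 0; auto.
- exact: x_seq_notin_tower.
- by apply: subfieldD => //; apply: (KM) => //; rewrite expr2; apply: KM.
- by rewrite mulr2n; apply: subfieldD; auto.
- exact: subfield_nat.
- exact: subfield0.
- by rewrite -Hw; ring.
by move=> -> /eqP; rewrite mulrn_eq0 /= => /eqP.
Qed.

(** A square root of d lying in a level of the tower has to lie in the first
    one, Q(sqrt nu): if it is [u + v * x n.+1] with [v != 0], comparing
    coordinates gives [u = 0], so [d * (nu + x n)] is the square of
    [v * (nu + x n)] in [tower n.+1], which [tower_norm_square] forbids.  In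
    Q(sqrt nu) the same comparison makes d either a rational square or nu
    times one. *)
Lemma tower_sqrt n (d : nat) w : (0 < d)%N -> tower n.+1 w -> w ^+ 2 = d%:R ->
  exists k : nat, (d = k ^ 2)%N \/ (d * nu = k ^ 2)%N.
Proof.
move=> d0; elim: n w => [|n IHn] w [u Ku [v Kv <-]] Hw.
  have [d1 uv0] := @tower_coef 0 d u v Ku Kv Hw.
  case: Ku Kv d1 uv0 => [a _ <-] [b _ <-] d1 /eqP; rewrite mulf_eq0 !fmorph_eq0.
  move=> /orP[] /eqP z0; move: d1; rewrite z0 rmorph0 expr0n /= ?(mul0r, addr0, add0r) => d1.
    have : (b * nu%:R) ^+ 2 = (Posz (d * nu))%:~R.
      rewrite -pmulrn; apply: (fmorph_inj (ratr : rat -> R)).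
      by rewrite rmorphXn rmorphM /= !rmorph_nat natrM -d1 x_seq0_sqr exprMn; ring.
    by move=> /rat_sqr_int[k [Hk]]; exists k; right.
  have : a ^+ 2 = (Posz d)%:~R.
    by rewrite -pmulrn; apply: (fmorph_inj (ratr : rat -> R)); rewrite rmorphXn /= rmorph_nat.
  by move=> /rat_sqr_int[k [Hk]]; exists k; left.
have [d1 uv0] := @tower_coef n.+1 d u v Ku Kv Hw.
move/eqP: uv0; rewrite mulf_eq0 => /orP[] /eqP z0; last first.
  by apply: (IHn u) => //; move: d1; rewrite z0 expr0n /= mul0r addr0.
move: d1; rewrite z0 expr0n /= add0r x_seqS_sqr => d1.
have [||||q Hq] := @tower_norm_square n nu d (v * (nu%:R + x n)).
- by move=> j _; exact: x_seq_notin_tower.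
- by rewrite eqz_nat -lt0n.
- apply: subfieldM => //; apply: subfieldD => //; last exact: mem_tower.
  exact: subfield_nat.
- by rewrite -!pmulrn -d1 exprMn; ring.
exfalso; exact: iter_sqstep_nsquare Hq.
Qed.

End Tower.
Arguments tower R nu n : clear implicits.

(** * Chebyshev polynomials *)

Fixpoint cheb_pair n : {poly int} * {poly int} :=
  if n is n'.+1 then let ab := cheb_pair n' in (ab.2, 'X * ab.2 - ab.1) else (2, 'X).
(** The integral normalization 2 T_n(X/2) of the Chebyshev polynomials: the
    one for which [z + z^-1] is sent to [z ^+ n + z ^- n]. *)
Definition cheb n := (cheb_pair n).1.

Lemma chebS n : cheb n.+2 = 'X * cheb n.+1 - cheb n.
Proof. by []. Qed.

Lemma cheb_horner (S : comNzRingType) (z w : S) n : z * w = 1 ->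
  (map_poly intr (cheb n)).[z + w] = z ^+ n + w ^+ n.
Proof.
move=> zw; suff [] : (map_poly intr (cheb n)).[z + w] = z ^+ n + w ^+ n /\
  (map_poly intr (cheb n.+1)).[z + w] = z ^+ n.+1 + w ^+ n.+1 by [].
elim: n => [|n [IH1 IH2]].
  rewrite /cheb /= map_polyX rmorph_nat; split; last by rewrite hornerX !expr1.
  by rewrite hornerMn hornerC !expr0.
split=> //; rewrite chebS rmorphB rmorphM /= map_polyX !hornerE IH1 IH2.
have -> : z ^+ n.+2 + w ^+ n.+2 = (z + w) * (z ^+ n.+1 + w ^+ n.+1)
  - (z * w) * (z ^+ n + w ^+ n) by rewrite !exprS; ring.
by rewrite zw mul1r.
Qed.

Lemma cheb_cos (R : realType) (t : R) n :
  (map_poly intr (cheb n)).[2 * cos t] = 2 * cos (t *+ n).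
Proof.
suff [] : (map_poly intr (cheb n)).[2 * cos t] = 2 * cos (t *+ n) /\
  (map_poly intr (cheb n.+1)).[2 * cos t] = 2 * cos (t *+ n.+1) by [].
elim: n => [|n [IH1 IH2]].
  rewrite /cheb /= map_polyX rmorph_nat; split; last by rewrite hornerX.
  by rewrite hornerMn hornerC mulr0n cos0 mulr1.
split=> //; rewrite chebS rmorphB rmorphM /= map_polyX !hornerE IH1 IH2.
rewrite (mulrSr t n.+1) cosD.
have -> : t *+ n = t *+ n.+1 - t by rewrite mulrSr addrK.
by rewrite cosB; ring.
Qed.

Lemma cheb_bound (R : realType) (s : R) n : -2 <= s <= 2 ->
  `|(map_poly intr (cheb n)).[s]| <= 2.
Proof.
move=> /andP[s1 s2]; have -> : s = 2 * cos (acos (s / 2)).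
  rewrite acosK; first by rewrite mulrC divfK.
  by rewrite in_itv /=; apply/andP; split; lra.
rewrite cheb_cos ler_norml; have := cos_le1 (acos (s / 2) *+ n).
have := cos_geN1 (acos (s / 2) *+ n); lra.
Qed.

(** * Kronecker's theorem *)

(** A lattice argument: the remainders modulo [p] have integral coefficients,
    and these are bounded because they are obtained from the values at the
    distinct points [a i] by inverting a Vandermonde matrix.  There are only
    finitely many such remainders. *)
Lemma rmodp_collision (R : realType) (d : nat) (p : {poly int}) (a : 'I_d -> R)
    (g : nat -> {poly int}) (b : R) :
  p \is monic -> size p = d.+1 -> injective a ->
  (forall i, root (map_poly intr p) (a i)) ->
  (forall k i, `|(map_poly intr (g k)).[a i]| <= b) ->
  exists k l, [/\ (k < l)%N & Pdiv.CommonRing.rmodp (g k) p = Pdiv.CommonRing.rmodp (g l) p].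
Proof.
move=> pm sp ainj pa gb.
pose h k := Pdiv.CommonRing.rmodp (g k) p.
have sh k : (size (h k) <= d)%N.
  by rewrite -ltnS -sp Pdiv.CommonRing.ltn_rmodpN0 // monic_neq0.
have ha k i : (map_poly intr (h k)).[a i] = (map_poly intr (g k)).[a i].
  rewrite [in RHS](Pdiv.RingMonic.rdivp_eq pm (g k)) rmorphD rmorphM /= hornerD hornerM.
  by rewrite (rootP (pa i)) mulr0 add0r.
pose V := Vandermonde d (\row_j a j).
have Vu : V \in unitmx.
  rewrite unitmxE det_Vandermonde unitfE; apply/prodf_neq0 => i _.
  apply/prodf_neq0 => j ij; rewrite !mxE subr_eq0 (inj_eq ainj).
  by apply/eqP => ji; rewrite ji ltnn in ij.
pose c k : 'rV[R]_d := \row_i ((h k)`_i)%:~R.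
have cV k : c k *m V = \row_j (map_poly intr (g k)).[a j].
  apply/rowP => j; rewrite !mxE -ha (@horner_coef_wide _ d); last first.
    by rewrite (leq_trans (size_poly _ _)).
  by apply: eq_bigr => i _; rewrite !mxE coef_map.
pose W := invmx V; pose B := \sum_i \sum_j `|W i j| * b.
have b0 (i : 'I_d) : 0 <= b := le_trans (normr_ge0 _) (gb 0%N i).
have cB k i : `|((h k)`_i)%:~R : R| <= B.
  have [id|di] := ltnP i d; last first.
    rewrite nth_default ?(leq_trans (sh k)) // normr0.
    by apply: sumr_ge0 => i' _; apply: sumr_ge0 => j _; rewrite mulr_ge0 // (b0 i').
  have -> : ((h k)`_i)%:~R = (c k *m V *m W) 0 (Ordinal id) by rewrite mulmxK // mxE.
  rewrite cV mxE; apply: le_trans (ler_norm_sum _ _ _) _; apply: ler_sum => j _.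
  rewrite mxE normrM mulrC.
  apply: (@le_trans _ _ (`|W j (Ordinal id)| * b)); first by rewrite ler_wpM2l.
  rewrite (bigD1 (Ordinal id)) //= lerDl; apply: sumr_ge0 => m _.
  by rewrite mulr_ge0 // (b0 j).
pose M := Num.truncn B.
have hM k i : (absz ((h k)`_i)%R <= M)%N.
  rewrite /M truncn_ge_nat; last by apply: le_trans (cB 0%N 0%N).
  by apply: le_trans (cB k i); rewrite -intr_norm -abszE natr_absz.
(* Shifting by M turns the coefficients, which lie in [-M, M], into ordinals. *)
pose code k := [ffun i : 'I_d => inord (absz ((h k)`_i + M%:Z)) : 'I_(M + M).+1].
have codeI k l : code k = code l -> h k = h l.
  move=> e; apply/polyP => i; have [id|di] := ltnP i d; last first.
    by rewrite !nth_default ?(leq_trans (sh _)).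
  move/ffunP: e => /(_ (Ordinal id)); rewrite !ffunE => /(congr1 val) /=.
  move: (hM k i) (hM l i); move: (h k)`_i (h l)`_i => u v hk hl.
  have bd (w : int) : (absz w <= M)%N -> (absz (w + M%:Z)%R < (M + M).+1)%N by lia.
  rewrite !inordK ?bd // => e; lia.
pose n := #|{ffun 'I_d -> 'I_(M + M).+1}|.
have : ~~ injectiveb [ffun k : 'I_n.+1 => code k].
  apply/injectiveP => /leq_card; rewrite card_ord -/n; lia.
move=> /injectivePn[k [l kl]]; rewrite !ffunE => /codeI e.
by move: kl; rewrite neq_ltn => /orP[kl|kl]; [exists k, l|exists l, k].
Qed.

(** The minimal polynomial divides an integral monic polynomial, so Gauss's
    lemma makes it integral. *)
Lemma integral_minpoly (R : realType) (r : R) :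
  integralOver (intr : int -> R) r ->
  exists2 p : {poly int}, p \is monic & is_minpolyQ (pZtoQ p) r.
Proof.
move=> [q qm qr].
have map_ratr (s : {poly int}) : map_poly (ratr : rat -> R) (pZtoQ s) = map_poly intr s.
  by rewrite -map_poly_comp; apply: eq_map_poly => a /=; rewrite rmorph_int.
pose P n := `[<exists s : {poly rat}, [/\ s != 0, root (map_poly ratr s) r & size s = n]>].
have exP : exists n, P n.
  exists (size (pZtoQ q)); apply/asboolP; exists (pZtoQ q); split => //; last by rewrite map_ratr.
  by rewrite map_poly_eq0_id0 ?(monicP qm) ?rmorph1 ?oner_eq0 // monic_neq0.
case: (ex_minnP exP) => n /asboolP[s [s0 sr ssz]] min_n.
have irr_s : irreducible_poly s.
  apply/(subfx_irreducibleP sr s0) => t tr t0; rewrite ssz; apply: min_n.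
  by apply/asboolP; exists t.
have sq : s %| pZtoQ q.
  rewrite /dvdp; apply: contraT => m0.
  have := ltn_modp (pZtoQ q) s; rewrite s0 ltnNge => /negP[].
  rewrite ssz; apply: min_n; apply/asboolP; exists (pZtoQ q %% s); split=> //.
  move: qr; rewrite -map_ratr {1}(divp_eq (pZtoQ q) s) rmorphD rmorphM /= !rootE hornerD hornerM.
  by rewrite (rootP sr) mulr0 add0r.
have [s1 [a a0 Ds] [t Dq]] := dvdpP_rat_int sq.
have : lead_coef t * lead_coef s1 = 1.
  by rewrite mulrC -lead_coefM -Dq (monicP qm).
move=> /intUnitRing.unitzPl l1.
(* The integral factor has leading coefficient 1 or -1, so multiplying by it
   makes the factor monic. *)
have l2 : lead_coef s1 * lead_coef s1 = 1 by move: l1; rewrite qualifE /= => /orP[] /eqP ->.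
exists (lead_coef s1 *: s1).
  by rewrite monicE lead_coefZ l2.
have e : s = (a * (lead_coef s1)%:~R) *: pZtoQ (lead_coef s1 *: s1).
  by rewrite Ds map_polyZ scalerA -mulrA -intrM l2 mulr1.
have c0 : a * (lead_coef s1)%:~R != 0.
  by rewrite mulf_neq0 // intr_eq0; apply/eqP => l0; rewrite l0 in l2.
split.
- by rewrite monicE lead_coef_map_inj //= ?lead_coefZ ?l2 //; exact: intr_inj.
- have sE : s %= pZtoQ (lead_coef s1 *: s1) by rewrite {1}e eqp_scale.
  case: irr_s => sz1 dv; split; first by rewrite -(eqp_size sE).
  by move=> u u1; rewrite -(eqp_dvdr _ sE) => us; apply: eqp_trans sE; exact: dv.
- move: sr; rewrite e map_polyZ rootE hornerZ mulf_eq0 fmorph_eq0 (negPf c0); exact.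
Qed.

Lemma irreducible_separable (p : {poly rat}) : irreducible_poly p -> separable_poly p.
Proof.
move=> irr_p; have p0 := irredp_neq0 irr_p; case: (irr_p) => sp dv.
rewrite unlock coprimep_def; apply: contraT => g1.
have gp := dv _ g1 (dvdp_gcdl _ _).
have : p %| p^`() by rewrite -(eqp_dvdl _ gp) dvdp_gcdr.
move/dvdp_leq; rewrite polyorder.size_deriv -size_poly_gt0 polyorder.size_deriv.
by case: (size p) sp => [|[|k]] //= _ /(_ isT); rewrite ltnn.
Qed.

(** Over the complex numbers an irreducible rational polynomial splits with
    distinct roots; if these are all real they are distinct real roots, as
    many as the degree. *)
Lemma totally_real_roots (R : realType) (p : {poly rat}) (r t : R) : is_minpolyQ p r ->
  (forall z : R[i], root (map_poly ratr p) z -> exists s : R, z = s%:C /\ 0 < s < t) ->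
  exists d (a : 'I_d -> R), [/\ size p = d.+1, injective a, (forall i, root (map_poly ratr p) (a i))
    & forall i, 0 < a i < t].
Proof.
move=> [pm irr_p pr] Hp.
have [rs Drs] := closed_field_poly_normal (map_poly (ratr : rat -> R[i]) p).
rewrite lead_coef_map (monicP pm) rmorph1 scale1r in Drs.
have urs : uniq rs by rewrite -separable_prod_XsubC -Drs separable_map irreducible_separable.
have rsP z : z \in rs -> exists s : R, z = s%:C /\ 0 < s < t.
  by move=> zrs; apply: Hp; rewrite Drs root_prod_XsubC.
pose a (i : 'I_(size rs)) := complex.Re rs`_i.
have aE (i : 'I_(size rs)) : rs`_i = (a i)%:C.
  by rewrite /a; have [s [-> _]] := rsP rs`_i (mem_nth 0 (ltn_ord i)).
exists (size rs), a; split.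
- by rewrite -(size_map_poly (ratr : rat -> R[i])) Drs size_prod_XsubC.
- move=> i j ij; apply: val_inj; apply/eqP; rewrite -(nth_uniq 0 (ltn_ord i) (ltn_ord j) urs).
  by rewrite !aE ij.
- move=> i; rewrite -(fmorph_root (real_complex R)) -map_poly_comp.
  have : root (map_poly (ratr : rat -> R[i]) p) rs`_i by rewrite Drs root_prod_XsubC mem_nth.
  rewrite aE; congr (root _ _); apply: eq_map_poly => q /=; by rewrite fmorph_rat.
- by move=> i; have [s [e H]] := rsP rs`_i (mem_nth 0 (ltn_ord i)); rewrite /a e.
Qed.

(** The point z of the unit circle with real part [s / 2], and its conjugate
    w = 1/z. *)
Lemma circle_point (R : realType) (s : R) : -2 <= s <= 2 ->
  exists z w : R[i], z * w = 1 /\ z + w = s%:C.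
Proof.
move=> /andP[s1 s2]; pose b := Num.sqrt (1 - (s / 2) ^+ 2).
have b2 : b ^+ 2 = 1 - (s / 2) ^+ 2.
  by rewrite sqr_sqrtr //; nra.
exists ((s / 2) +i* b), ((s / 2) -i* b); split.
  apply/eqP; rewrite eq_complex /=; apply/andP; split; apply/eqP; last by ring.
  by rewrite mulrN opprK -!expr2 b2; ring.
by apply/eqP; rewrite eq_complex /=; apply/andP; split; apply/eqP; field.
Qed.

(** Write [r - 2 = z + 1/z] with z on the unit circle.  All conjugates of
    [r - 2] lie in [-2, 2], an interval that the polynomials [cheb n] map to
    itself, so two of them, say the k-th and the l-th, take the same value at
    [r - 2] by [rmodp_collision].  Then
    [z ^+ k + z ^- k = z ^+ l + z ^- l], and z is a root of unity. *)
Lemma kronecker (R : realType) (r : R) :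
  integralOver (intr : int -> R) r -> totally_between r 4%:R%:E ->
  exists z w : R[i], [/\ z * w = 1, z + w = (r - 2)%:C & exists n, n.-primitive_root z].
Proof.
move=> rint rb; have [p pm pmin] := integral_minpoly rint.
have [|d [a [sp ainj pa ab]]] := @totally_real_roots R _ r 4 pmin.
  move=> z pz; have [|s [-> sb]] := rb z; last by exists s; rewrite !lte_fin in sb.
  by exists (map_poly intr p).
have map_ratr : map_poly (ratr : rat -> R) (map_poly intr p) = map_poly intr p.
  by rewrite -map_poly_comp; apply: eq_map_poly => c /=; rewrite rmorph_int.
have {}sp : size p = d.+1 by rewrite -sp size_map_inj_poly //; exact: intr_inj.
pose g k := cheb k \Po ('X - 2).
have gE k (y : R) : (map_poly intr (g k)).[y] = (map_poly intr (cheb k)).[y - 2].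
  by rewrite /g map_comp_poly rmorphB /= map_polyX rmorph_nat horner_comp !hornerE.
have [||k [l [kl rkl]]] := @rmodp_collision R d p a g 2 pm sp ainj _ _.
- by move=> i; rewrite -map_ratr.
- by move=> k i; rewrite gE cheb_bound //; have := ab i; lra.
have pr : root (map_poly intr p) r by case: pmin => _ _; rewrite map_ratr.
have gr m : (map_poly intr (g m)).[r] = (map_poly intr (Pdiv.CommonRing.rmodp (g m) p)).[r].
  rewrite {1}(Pdiv.RingMonic.rdivp_eq pm (g m)) rmorphD rmorphM /= hornerD hornerM.
  by rewrite (rootP pr) mulr0 add0r.
have rb2 : 0 < r < 4.
  have [|s [[->]]] := rb r%:C; last by rewrite !lte_fin.
  exists (map_poly intr p); split=> //; case: pmin => _ _ h.
  have := h; rewrite -(fmorph_root (real_complex R)) -map_poly_comp.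
  by congr (root _ _); apply: eq_map_poly => q /=; rewrite fmorph_rat.
have [|z [w [zw zws]]] := @circle_point R (r - 2); first by lra.
exists z, w; split=> //.
have chebC m : (map_poly intr (cheb m)).[z + w] = ((map_poly intr (g m)).[r])%:C.
  rewrite gE zws -[RHS](horner_map (real_complex R)) -map_poly_comp.
  by congr (_.[_]); apply: eq_map_poly => q /=; rewrite rmorph_int.
have e : z ^+ k + w ^+ k = z ^+ l + w ^+ l.
  by rewrite -!cheb_horner // !chebC !gr rkl.
have wk m : z ^+ m * w ^+ m = 1 by rewrite -exprMn zw expr1n.
suff [n n0 zn] : exists2 n, (0 < n)%N & z ^+ n = 1.
  by have [m pm' _] := prim_order_exists n0 zn; exists m.
(* The relation e, multiplied out with z w = 1, factors. *)
have : (z ^+ k - z ^+ l) * (1 - w ^+ k * w ^+ l) = 0.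
  have -> : (z ^+ k - z ^+ l) * (1 - w ^+ k * w ^+ l) = z ^+ k - z ^+ l
     - (z ^+ k * w ^+ k) * w ^+ l + (z ^+ l * w ^+ l) * w ^+ k by ring.
  by rewrite !wk !mul1r -[RHS](subrr (z ^+ l + w ^+ l)) -{1}e; ring.
move/eqP; rewrite mulf_eq0 => /orP[]; rewrite subr_eq0 => /eqP h.
  exists (l - k)%N; first by rewrite subn_gt0.
  by have := wk k; rewrite h -[X in z ^+ X](subnK (ltnW kl)) exprD -mulrA wk mulr1.
exists (k + l)%N; first by rewrite addn_gt0 (leq_trans _ kl) ?orbT.
by have := wk (k + l)%N; rewrite exprD [w ^+ _]exprD -h mulr1.
Qed.

(** * Square roots of primes from roots of unity *)

Section RootsOfUnity.
Variables (R : realType) (K : set R) (z w : R[i]).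
Hypotheses (hK : is_subfield K) (zw : z * w = 1) (Kzw : exists2 s, K s & z + w = s%:C).

Lemma power_sum_in k : exists2 t, K t & t%:C = z ^+ k + w ^+ k.
Proof.
have [s Ks es] := Kzw; exists (map_poly intr (cheb k)).[s]; first exact: subfield_horner.
rewrite -cheb_horner // es -(horner_map (real_complex R)) -map_poly_comp.
by congr (_.[_]); apply: eq_map_poly => q /=; rewrite rmorph_int.
Qed.

(** Each factor changes sign under the exchange of [z] and [w], so the product
    is symmetric in them, hence a polynomial in [z + w]. *)
Lemma power_diff_mul_in k l : exists2 t, K t &
  t%:C = (z ^+ k - w ^+ k) * (z ^+ (k + l) - w ^+ (k + l)).
Proof.
have [t Kt et] := power_sum_in (k + (k + l)); have [u Ku eu] := power_sum_in l.
exists (t - u); first exact: subfieldB.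
rewrite rmorphB /= et eu; rewrite !exprD.
have : z ^+ k * w ^+ k = 1 by rewrite -exprMn zw expr1n.
move: (z ^+ k) (w ^+ k) (z ^+ l) (w ^+ l) => a b c d ab.
have -> : (a - b) * (a * c - b * d) = a * (a * c) + b * (b * d) - (a * b) * (c + d) by ring.
by rewrite ab mul1r.
Qed.

(** The square root is [z + w]: the square of [z] is a square root of -1, so
    that of [w] is its opposite. *)
Lemma sqrt2_of_root8 : 8.-primitive_root z -> exists2 t, K t & t ^+ 2 = 2%:R.
Proof.
move=> pz; have [t Kt et] := power_sum_in 1; exists t => //.
apply: (fmorph_inj (real_complex R)); rewrite rmorphXn /= et !expr1 rmorph_nat.
have z4 : z ^+ 4 = -1.
  have : (z ^+ 4 - 1) * (z ^+ 4 + 1) = 0.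
    have -> : (z ^+ 4 - 1) * (z ^+ 4 + 1) = z ^+ 8 - 1 by ring.
    by rewrite (prim_expr_order pz) subrr.
  move/eqP; rewrite mulf_eq0 subr_eq0 addr_eq0 => /orP[|/eqP //].
  by rewrite -(prim_order_dvd pz).
have -> : (z + w) ^+ 2 = z ^+ 2 + w ^+ 2 + 2 * (z * w) by ring.
rewrite zw mulr1; suff -> : w ^+ 2 = - z ^+ 2 by rewrite subrr add0r.
have : (z * w) ^+ 2 * z ^+ 2 = z ^+ 2 by rewrite zw expr1n mul1r.
have -> : (z * w) ^+ 2 * z ^+ 2 = z ^+ 4 * w ^+ 2 by ring.
by rewrite z4 mulN1r => <-; rewrite opprK.
Qed.

(** This is the value at 1 of (X^n - 1) / (X - 1). *)
Lemma prod_one_sub_root n : (0 < n)%N -> n.-primitive_root z ->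
  \prod_(1 <= k < n) (1 - z ^+ k) = n%:R.
Proof.
move=> n0 pz; have := factor_Xn_sub_1 pz; rewrite big_ltn // expr0 subrX1 -polyC1.
have X1 : 'X - 1%:P != 0 :> {poly R[i]} by rewrite polyXsubC_eq0.
move/(mulfI X1)/(congr1 (fun p => p.[1])); rewrite horner_prod horner_sum.
under eq_bigr do rewrite !hornerE; move=> ->.
by under eq_bigr do rewrite !hornerE expr1n; rewrite sumr_const card_ord.
Qed.

End RootsOfUnity.

(** With n = 4j + 1, pair the factors k and n - k in the product of the
    [1 - z ^+ (2 * k)], which is n.  Each pair multiplies to
    [- (z ^+ k - w ^+ k) ^+ 2], and the 2j signs cancel, so n is the square of
    the product of the [z ^+ k - w ^+ k] for k from 1 to 2j.  That product has
    evenly many factors; taken two at a time they lie in [K] by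
    [power_diff_mul_in]. *)
Lemma sqrt_prime_of_root (R : realType) (K : set R) (z w : R[i]) (j : nat) :
  is_subfield K -> z * w = 1 -> (exists2 s, K s & z + w = s%:C) ->
  (4 * j).+1.-primitive_root z -> exists2 t, K t & t ^+ 2 = (4 * j).+1%:R.
Proof.
move=> hK zw Kzw pz; set n := (4 * j).+1.
have zwk k : z ^+ k * w ^+ k = 1 by rewrite -exprMn zw expr1n.
have pz2 : n.-primitive_root (z ^+ 2).
  by rewrite prim_root_exp_coprime // ?coprime2n ?coprimen2 /n -addn1 oddD oddM.
pose D k := z ^+ k - w ^+ k.
have Dn : \prod_(1 <= k < (2 * j).+1) D k ^+ 2 = n%:R.
  rewrite -(prod_one_sub_root _ pz2) //.
  rewrite (@big_cat_nat _ _ _ (2 * j).+1 1 n) //=; last by rewrite /n; lia.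
  have -> : \prod_((2 * j).+1 <= k < n) (1 - (z ^+ 2) ^+ k) =
      \prod_(1 <= k < (2 * j).+1) (1 - (w ^+ 2) ^+ k).
    rewrite big_nat_rev /= -{1}[(2 * j).+1]add1n big_addn.
    have -> : (n - 2 * j = (2 * j).+1)%N by rewrite /n; lia.
    apply: eq_big_nat => k /andP[k1 k2]; congr (1 - _).
    have -> : ((2 * j).+1 + n - (k + 2 * j).+1 = n - k)%N by rewrite /n; lia.
    have kn : (k <= n)%N by rewrite /n; lia.
    have : (z * w) ^+ (2 * k) * (z ^+ 2) ^+ (n - k) = (z ^+ 2) ^+ n * (w ^+ 2) ^+ k.
      by rewrite -[X in (z ^+ 2) ^+ X * _](subnK kn) exprMn !exprM [in RHS]exprD; ring.
    by rewrite zw expr1n mul1r (prim_expr_order pz2) mul1r.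
  rewrite -big_split /=.
  have -> : \prod_(1 <= k < (2 * j).+1) ((1 - (z ^+ 2) ^+ k) * (1 - (w ^+ 2) ^+ k))
     = \prod_(1 <= k < (2 * j).+1) (-1 * D k ^+ 2).
    apply: eq_big_nat => k _; rewrite !(exprAC _ 2) /D; move: (zwk k).
    by move: (z ^+ k) (w ^+ k) => a b ab; ring: ab.
  by rewrite [RHS]big_split /= prodr_const_nat subn1 exprM sqrrN expr1n expr1n mul1r.
have [t Kt et] : exists2 t, K t & t%:C = \prod_(1 <= k < (2 * j).+1) D k.
  elim: j {n pz pz2 Dn} => [|j [t Kt et]].
    by exists 1; [case: hK | rewrite big_geq].
  have [u Ku eu] := power_diff_mul_in hK zw Kzw (2 * j).+1 1.
  exists (t * u); first exact: subfieldM.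
  have -> : (2 * j.+1 = (2 * j).+2)%N by lia.
  rewrite rmorphM /= et eu [RHS]big_nat_recr // [X in _ = X * _]big_nat_recr // -[RHS]mulrA /D.
  by rewrite addn1.
exists t => //; apply: (fmorph_inj (real_complex R)).
by rewrite rmorphXn /= et rmorph_nat -Dn prodrXl.
Qed.

(** * Degrees of roots of unity *)

(** Transfer of [minCpoly_cyclotomic] from algebraic numbers to rational
    polynomials. *)
Lemma irreducible_Cyclotomic n :
  (0 < n)%N -> irreducible_poly (pZtoQ (Cyclotomic n)).
Proof.
move=> n_gt0; have [z prim_z] := C_prim_root_exists n_gt0.
have [pf [Dpf mon_pf] dv_pf] := minCpolyP z.
have <- : pf = pZtoQ (Cyclotomic n).
  apply: (map_inj_poly (fmorph_inj (ratr : rat -> algC))); first exact: rmorph0.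
  rewrite -Dpf (minCpoly_cyclotomic prim_z) -(Cintr_Cyclotomic prim_z).
  rewrite -map_poly_comp; apply: eq_map_poly => a /=; by rewrite rmorph_int.
have pf0 : pf != 0 by exact: monic_neq0.
have zpf : root (map_poly ratr pf) z by rewrite dv_pf.
split.
  by rewrite -(size_map_poly (ratr : rat -> algC)) (root_size_gt1 _ zpf) ?map_poly_eq0.
move=> q q1 qdv; have /dvdpP[r Dr] := qdv.
have [r0 q0] : r != 0 /\ q != 0 by apply/norP; rewrite -mulf_eq0 -Dr.
move: zpf; rewrite Dr rmorphM rootM /= !dv_pf => /orP[] H; last by rewrite -Dr /eqp qdv.
have := dvdp_leq r0 H; rewrite Dr size_mul // leqNgt => /negP[].
have : (1 < size q)%N by rewrite ltn_neqAle eq_sym q1 size_poly_gt0.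
case: (size q) => [|[|k]] // _; rewrite addnS /= addnS ltnS; exact: leq_addr.
Qed.

(** The cyclotomic polynomial is the minimal polynomial of [y], and degrees are
    multiplicative in towers. *)
Lemma totient_dvd_dim (C : numFieldType) (L : fieldExtType rat)
    (phi : {rmorphism L -> C}) (y : L) n :
  n.-primitive_root (phi y) -> (totient n %| \dim {:L})%N.
Proof.
rewrite fmorph_primitive_root => prim_y; have n_gt0 := prim_order_gt0 prim_y.
(* As a root of X^n - 1, y is a root of a cyclotomic polynomial of index d
   dividing n; since y has exact order n, the index is n. *)
have [d dn ry] : exists2 d, (d %| n)%N & root (map_poly intr (Cyclotomic d)) y.
  have : root (map_poly (intr : int -> L) ('X^n - 1)) y.
    by rewrite rmorphB rmorph1 /= map_polyXn rootE !hornerE (prim_expr_order prim_y) subrr.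
  rewrite -prod_Cyclotomic // rmorph_prod /= rootE horner_prod prodf_seq_eq0 => /hasP[d].
  by rewrite -dvdn_divisors // => dn rd; exists d.
have d_gt0 : (0 < d)%N by apply: dvdn_gt0 dn.
have {dn} ? : d = n.
  apply/eqP; rewrite eqn_dvd dn /= (prim_order_dvd prim_y).
  have : map_poly (intr : int -> L) (Cyclotomic d) %| 'X^d - 1.
    rewrite -(map_polyXn (intr : {rmorphism int -> L})) -(rmorph1 (map_poly intr)) -rmorphB /=.
    rewrite -prod_Cyclotomic // rmorph_prod /=.
    rewrite (big_rem d) /=; last by rewrite -dvdn_divisors.
    exact: dvdp_mulr.
  move=> /dvdpP[r /(congr1 (fun q => q.[y]))]; rewrite hornerM (rootP ry) mulr0 !hornerE.
  by move/eqP; rewrite subr_eq0.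
subst d; pose P := map_poly (in_alg L) (pZtoQ (Cyclotomic n)).
have rP : root P y.
  by rewrite /P -map_poly_comp (eq_map_poly (g := intr)) // => a; exact: (rmorph_int (in_alg L)).
have PO : P \is a polyOver 1%VS by apply/polyOver1P; exists (pZtoQ (Cyclotomic n)).
have := minPoly_dvdp PO rP; have /polyOver1P[q Dq] := minPolyOver 1 y.
rewrite Dq dvdp_map => qP; have [_ /(_ q)] := irreducible_Cyclotomic d_gt0.
have szq : size q = (adjoin_degree 1 y).+1 by rewrite -(size_minPoly 1 y) Dq size_map_poly.
have sz1 : size q != 1%N by rewrite szq.
move=> /(_ sz1 qP) /eqp_size.
rewrite szq size_map_inj_poly ?size_Cyclotomic //; last exact: intr_inj.
move=> [<-]; have := dim_Fadjoin 1%AS y; rewrite dimv1 muln1 => <-.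
exact: field_dimS (subvf _).
Qed.

(** Adjoining to an embedded number field a root of a monic quadratic
    polynomial multiplies the degree by 1 or 2; [phi] and [psi] keep track of
    the embeddings. *)
Lemma quadratic_extension (C : numFieldType) (L : fieldExtType rat)
    (phi : {rmorphism L -> C}) (z : C) (a b : L) :
  z ^+ 2 + phi a * z + phi b = 0 ->
  exists (L' : fieldExtType rat) (psi : {rmorphism L' -> C}),
    [/\ forall x, exists y, psi y = phi x, exists y, psi y = z
      & \dim {:L'} = \dim {:L} \/ \dim {:L'} = (2 * \dim {:L})%N].
Proof.
move=> Hz; have [[y Hy]|nz] := EM (exists y, phi y = z).
  by exists L, phi; split => //; [move=> x; exists x | exists y | left].
pose p := 'X^2 + a *: 'X + b%:P.
have sp : size p = 3%N.
  rewrite /p -addrA size_polyDl size_polyXn // ltnS.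
  rewrite (leq_trans (size_polyD _ _)) // geq_max (leq_trans (size_scale_leq _ _)) ?size_polyX //.
  by rewrite (leq_trans (size_polyC_leq1 _)).
have rp : root (map_poly phi p) z.
  by rewrite /p !rmorphD /= map_polyXn map_polyZ map_polyX map_polyC rootE !hornerE -Hz.
have irr_p : irreducible_poly p.
  apply: cubic_irreducible; rewrite ?sp // => x; apply/negP.
  rewrite /p rootE !hornerE => /eqP px.
  (* The other root would be - a - x, so z would come from L. *)
  have : (z - phi x) * (z - phi (- a - x)) == 0.
    have {}px : phi x ^+ 2 + phi a * phi x + phi b = 0.
      by rewrite -[in RHS](rmorph0 phi) -px !rmorphD /= !rmorphM.
    rewrite !(rmorphD, rmorphN) /=; rewrite -(subrr 0) -{1}Hz -px; apply/eqP; ring.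
  by rewrite mulf_eq0 !subr_eq0 => /orP[] /eqP zx; apply: nz; [exists x|exists (- a - x)].
pose L1 := SubFieldExtType rp irr_p.
pose L' : fieldExtType rat := baseFieldType L1.
pose psi : {rmorphism L' -> C} := (@subfx_inj L C phi z p : {rmorphism L1 -> C}).
exists L', psi; split.
- by move=> x; exists (x%:A : L1); rewrite /psi /= subfx_inj_base // irredp_neq0.
- by exists (subfx_root phi z p); rewrite /psi /= subfx_inj_root // irredp_neq0.
right; rewrite -[RHS]/(2 * _)%N.
have : (fullv : {vspace L'}) = baseVspace (fullv : {vspace L1}).
  apply/vspaceP => x; rewrite mem_baseVspace memvf; apply/esym; exact: (@memvf _ L1 x).
move=> ->; rewrite dim_baseVspace; congr (_ * _)%N.
by rewrite dimvf; unfold dim; rewrite /= sp.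
Qed.

Lemma tower_number_field (R : realType) nu n :
  exists (L : fieldExtType rat) (phi : {rmorphism L -> R[i]}),
    (exists j, \dim {:L} = (2 ^ j)%N) /\ forall u, tower R nu n u -> exists y, phi y = u%:C.
Proof.
elim: n => [|n [L [phi [[j Lj] phiT]]]].
  exists rat^o, (ratr : {rmorphism rat -> R[i]}); split.
    by exists 0%N; rewrite dimvf.
  by move=> _ [q _ <-]; exists q; rewrite [RHS](fmorph_rat (real_complex R)).
have [b Hb] := phiT _ (tower_sqr R nu n).
have [|L' [psi [phi_psi [y0 Hy0] dL']]] := @quadratic_extension _ L phi (x_seq R nu n)%:C 0 (- b).
  by rewrite rmorph0 mul0r addr0 rmorphN Hb rmorphXn subrr.
exists L', psi; split.
  by case: dL' => ->; [exists j | exists j.+1; rewrite expnS]; rewrite Lj.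
move=> _ [u Ku [v Kv <-]]; have [yu Hu] := phiT u Ku; have [yv Hv] := phiT v Kv.
have [yu' Hu'] := phi_psi yu; have [yv' Hv'] := phi_psi yv.
by exists (yu' + yv' * y0); rewrite !(rmorphD, rmorphM) /= Hu' Hv' Hu Hv Hy0.
Qed.

(** Here [z] is a root of X^2 - s X + 1, so it generates at most a quadratic
    extension of a field whose degree is a power of 2. *)
Lemma totient_dvd_pow2 (R : realType) nu n (z w : R[i]) : z * w = 1 ->
  (exists2 s, tower R nu n s & z + w = s%:C) ->
  exists j, forall N k, N.-primitive_root (z ^+ k) -> (totient N %| 2 ^ j)%N.
Proof.
move=> zw [s Ks es]; have [L [phi [[j Lj] phiT]]] := tower_number_field R nu n.
have [y Hy] := phiT s Ks.
have [|L' [psi [_ [y0 Hy0] dL']]] := @quadratic_extension _ L phi z (- y) 1.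
  by rewrite rmorphN rmorph1 Hy -es -zw; ring.
have [i Li] : exists i, \dim {:L'} = (2 ^ i)%N.
  by case: dL' => ->; [exists j | exists j.+1; rewrite expnS]; rewrite Lj.
exists i => N k; rewrite -Hy0 -rmorphXn -Li; exact: totient_dvd_dim.
Qed.

Lemma dvdn_succ_expS a o : odd o -> (a.+1 %| (a ^ o).+1)%N.
Proof.
move=> oo.
have : (a.+1%:Z %| (a ^ o).+1%:Z)%Z.
  apply/dvdzP; exists (\sum_(i < o) a%:Z ^+ (o.-1 - i) * (-1) ^+ i).
  rewrite mulrC; have -> : a.+1%:Z = a%:Z - (-1) by rewrite opprK -addn1 PoszD.
  rewrite -subrXX -signr_odd oo expr1 opprK -addn1 PoszD; congr (_ + 1).
  by rewrite -!natz natrX.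
by rewrite dvdzE !absz_nat.
Qed.

(** The classical argument: if [p = 2 ^ e + 1] and [e = t * q] with q odd, then
    [2 ^ t + 1] divides p, so p is [2 ^ t + 1] where t is the 2-part of e. *)
Lemma fermat_prime_of_pow2 (p j : nat) : prime p -> (3 < p)%N -> (p.-1 %| 2 ^ j)%N ->
  fermat_prime p /\ exists i, p = (4 * i).+1.
Proof.
move=> pp p3 /(dvdn_pfactor _ _ (isT : prime 2))[e _ pe].
have e1 : (1 < e)%N by case: e pe => [|[|e]] //; lia.
have Dp : p = (2 ^ e + 1)%N by rewrite -pe; lia.
split; last first.
  exists (2 ^ (e - 2))%N; rewrite Dp -{1}(subnKC e1) expnD; lia.
split=> //; have e0 : (0 < e)%N by apply: ltnW.
have [q q2 De] := pfactor_coprime (isT : prime 2) e0.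
rewrite coprime2n in q2.
exists (logn 2 e); move: De; set t := (2 ^ _)%N => De.
have := dvdn_succ_expS (2 ^ t) q2; rewrite -expnM mulnC -De -[(2 ^ e).+1]addn1 -Dp.
move/(prime_nt_dvdP pp) => <- //.
  by rewrite addn1.
by rewrite eqSS expn_eq0.
Qed.

Lemma dvd12_cases (N : nat) : (0 < N)%N ->
  [\/ (N %| 12)%N, (8 %| N)%N, (9 %| N)%N | exists p, [/\ prime p, (3 < p)%N & (p %| N)%N]].
Proof.
move=> N0; have [d8|n8] := boolP (8 %| N)%N; first by constructor 2.
have [d9|n9] := boolP (9 %| N)%N; first by constructor 3.
have [[p hp]|np] := EM (exists p, [/\ prime p, (3 < p)%N & (p %| N)%N]).
  by constructor 4; exists p.
constructor 1; apply/dvdn_partP => // p; rewrite mem_primes => /and3P[pp _ pN].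
have p3 : (p <= 3)%N by rewrite leqNgt; apply/negP => p3; apply: np; exists p.
have p2 := prime_gt1 pp; rewrite p_part.
have l2 : (logn 2 N <= 2)%N by move: n8; rewrite (@pfactor_dvdn 2 3) // -ltnNge.
have l3 : (logn 3 N <= 1)%N by move: n9; rewrite (@pfactor_dvdn 3 2) // -ltnNge.
have [->|->] : p = 2%N \/ p = 3%N by lia.
  exact: (@dvdn_trans (2 ^ 2) _ _ (dvdn_exp2l 2 l2)).
by apply: dvdn_trans (dvdn_exp2l 3 l3) _.
Qed.

(** * Finiteness of the JR number *)

Lemma irreducible_dvdp (F : numFieldType) (p q : {poly rat}) (r : F) : irreducible_poly p ->
  root (map_poly ratr p) r -> root (map_poly ratr q) r -> p %| q.
Proof.
move=> [_ dv] pr qr.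
have gr : root (map_poly ratr (gcdp p q)) r by rewrite gcdp_map root_gcd pr.
have g1 : size (gcdp p q) != 1%N.
  apply/negP => /size_poly1P[c c0 e]; move: gr; rewrite e map_polyC rootC fmorph_eq0.
  by rewrite (negPf c0).
by rewrite -(eqp_dvdl _ (dv _ g1 (dvdp_gcdl _ _))) dvdp_gcdr.
Qed.

Section FiniteJR.
Variables (R : realType) (nu : nat).
Hypothesis nu2 : (2 <= nu)%N.
Local Notation x := (x_seq R nu).

Fixpoint iter_poly n : {poly rat} :=
  if n is n'.+1 then iter_poly n' \Po ('X^2 - nu%:R%:P) else 'X^2 - nu%:R%:P.

Lemma iter_polyS_horner (F : numFieldType) n (z : F) :
  (map_poly ratr (iter_poly n.+1)).[z] = (map_poly ratr (iter_poly n)).[z ^+ 2 - nu%:R].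
Proof.
rewrite /= map_comp_poly horner_comp rmorphB /= map_polyXn map_polyC /= !hornerE.
by rewrite ratr_nat.
Qed.

Lemma iter_poly0_horner (F : numFieldType) (z : F) :
  (map_poly ratr (iter_poly 0)).[z] = z ^+ 2 - nu%:R.
Proof. by rewrite /= rmorphB /= map_polyXn map_polyC /= !hornerE ratr_nat. Qed.

Lemma iter_poly_root n : root (map_poly ratr (iter_poly n)) (x n).
Proof.
elim: n => [|n IHn]; first by rewrite rootE iter_poly0_horner x_seq0_sqr subrr.
by rewrite rootE iter_polyS_horner x_seqS_sqr addrC addKr.
Qed.

Lemma complex_sqrt_real (z : R[i]) (c B : R) : 0 <= c <= B ^+ 2 -> 0 <= B -> z ^+ 2 = c%:C ->
  exists2 y : R, z = y%:C & `|y| <= B.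
Proof.
move=> /andP[c0 cB] B0 Hz; pose s := Num.sqrt c.
have s2 : s ^+ 2 = c by rewrite sqr_sqrtr.
have sB : s <= B by rewrite -(ger0_norm B0) -sqrtr_sqr ler_wsqrtr.
have s0 : 0 <= s := sqrtr_ge0 _.
have : (z - s%:C) * (z - (- s)%:C) == 0.
  have -> : (z - s%:C) * (z - (- s)%:C) = z ^+ 2 - (s ^+ 2)%:C 
    by rewrite rmorphN rmorphXn /=; ring.
  by rewrite s2 Hz subrr.
rewrite mulf_eq0 !subr_eq0 => /orP[] /eqP ->; [exists s => //| exists (- s) => //].
  by rewrite ger0_norm.
by rewrite normrN ger0_norm.
Qed.

(** If [z ^+ 2 - nu = y] with [y] real and [|y| <= nu], then
    [0 <= nu + y <= 2 * nu <= nu ^ 2], so [z] is real and again at most [nu]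
    in absolute value. *)
Lemma iter_poly_roots_real n (z : R[i]) : root (map_poly ratr (iter_poly n)) z ->
  exists2 y : R, z = y%:C & `|y| <= nu%:R.
Proof.
have nuR : 2 <= nu%:R :> R by rewrite ler_nat.
elim: n z => [|n IHn] z; rewrite rootE.
  rewrite iter_poly0_horner subr_eq0 => /eqP Hz.
  apply: (@complex_sqrt_real z nu%:R); [nra | lra | by rewrite Hz rmorph_nat].
rewrite iter_polyS_horner => /IHn[y Hy]; rewrite ler_norml => /andP[y1 y2].
apply: (@complex_sqrt_real z (nu%:R + y)); [nra | lra |].
by rewrite rmorphD /= -Hy rmorph_nat addrC subrK.
Qed.

Lemma x_seq_lt n : x n < x n.+1.
Proof.
have nuR : 2 <= nu%:R :> R by rewrite ler_nat.
elim: n => [|n IHn].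
  have x0 : 0 < x 0 by rewrite /= sqrtr_gt0; lra.
  by rewrite /= ltr_sqrt /= -/(x 0); lra.
rewrite [x n.+1]/= [x n.+2]/= ltr_sqrt; first by rewrite ltrD2l.
by have := x_seq_ge0 R nu n.+1; rewrite /= ; lra.
Qed.

Lemma x_seq_integral n : integralOver (intr : int -> R) (x n).
Proof.
elim: n => [|n IHn].
  exists ('X^2 - nu%:R%:P); first by rewrite monicXnsubC.
  by rewrite rmorphB /= map_polyXn map_polyC /= rootE !hornerE x_seq0_sqr rmorph_nat subrr.
have : integralOver (intr : int -> R) (nu%:R + x n).
  exact: (@integral_add _ _ (intr : {rmorphism int -> R}) _ _ (integral_nat _ _) IHn).
set a := nu%:R + x n => ia.
apply: (@integral_root_monic _ _ (intr : {rmorphism int -> R}) _ ('X^2 - a%:P)).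
- by rewrite monicXnsubC.
- by rewrite rootE !hornerE x_seqS_sqr subrr.
apply/integral_poly => i; rewrite coefB coefXn coefC; apply: integral_sub; first exact: integral_nat.
by case: (i == 0%N) => //; exact: (integral_nat _ 0).
Qed.

(** The witnesses are the [x_seq R nu n + nu + 1], whose conjugates lie in the
    interval from 1 to [2 * nu + 1]. *)
Lemma JR_lty : (JR (O_tower R nu) < +oo)%E.
Proof.
have nuR : 2 <= nu%:R :> R by rewrite ler_nat.
apply: (@le_lt_trans _ _ (2 * nu%:R + 2)%:E); last exact: ltry.
apply: ereal_inf_lbound; split=> //.
pose f n := x n + (nu%:R + 1).
have finj : injective f.
  by move=> k l /addIr; exact: (inc_inj (Order.NatMonotonyTheory.incnP x_seq_lt)).
have : infinite_set (f @` setT).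
  by rewrite (eq_finite_set (inj_card_eq _)); [exact: infinite_nat | exact: in2W].
apply: sub_infinite_set => _ [n _ <-]; split.
  exists n => //; split.
    move=> K [/is_subfieldP hK Kx]; apply: subfieldD => //; first exact: Kx.
    by apply: subfieldD => //; [exact: subfield_nat| case: hK].
  apply: (@integral_add _ _ (intr : {rmorphism int -> R})); first exact: x_seq_integral.
  by rewrite natr1; exact: integral_nat.
move=> z [p [[pm irr_p pr] pz]].
pose q := iter_poly n \Po ('X - (nu%:R + 1)%:P).
have qE (F : numFieldType) (y : F) :
    (map_poly ratr q).[y] = (map_poly ratr (iter_poly n)).[y - (nu%:R + 1)].
  rewrite map_comp_poly horner_comp rmorphB /= map_polyX map_polyC /= !hornerE.
  by rewrite rmorphD rmorph1 /= ratr_nat.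
have /dvdpP[u Du] : p %| q.
  apply: irreducible_dvdp irr_p pr _; rewrite rootE qE /f addrK.
  exact: iter_poly_root.
have : root (map_poly ratr q) z by rewrite Du rmorphM /= rootM pz orbT.
rewrite rootE qE => /iter_poly_roots_real[y Hy]; rewrite ler_norml => /andP[y1 y2].
exists (y + (nu%:R + 1)); split.
  by rewrite rmorphD /= -Hy rmorphD rmorph1 rmorph_nat subrK.
by rewrite !lte_fin; lra.
Qed.

End FiniteJR.

(** * The number 4 and the main result *)

Lemma prime_mul_nsquare (q n k : nat) : prime q -> (0 < n)%N -> ~~ odd (logn q n) ->
  (q * n <> k ^ 2)%N.
Proof.
move=> pq n0 even_n e; have := congr1 (odd \o logn q) e; rewrite /= (lognM _ (prime_gt0 pq) n0).
by rewrite (logn_prime _ pq) eqxx lognX oddD oddM (negPf even_n).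
Qed.

(** Any r counted by the set comes from a root of unity of order dividing 12, as the other
    orders would force a forbidden degree or a forbidden square root into the
    tower. *)
Lemma A_set_not4 (R : realType) (m mu nu : nat) : odd mu ->
  (forall p : nat, fermat_prime p -> (3 < p)%N -> ~ square_mod p mu) ->
  nu = (2 ^ (2 * m) * mu)%N -> ~ A_set (O_tower R nu) 4%:R%:E.
Proof.
move=> hodd hsq hnu.
have mu0 : (0 < mu)%N by case: mu hodd {hsq hnu}.
have nu0 : (0 < nu)%N by rewrite hnu muln_gt0 expn_gt0.
have nu_nsq k : nu <> (k ^ 2)%N.
  (* 5 is a Fermat prime, so mu is not a square. *)
  move=> e; apply: (hsq 5%N) => //; first by split=> //; exists 1%N.
  have : (2 ^ m %| k)%N by rewrite -(@dvdn_pexp2r _ _ 2) // -e hnu -expnM mulnC dvdn_mulr.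
  move=> /dvdnP[k' Dk]; exists k'; congr (_ %% _)%Z.
  have -> : mu = (k' ^ 2)%N; last by rewrite -!natz natrX.
  apply/eqP; rewrite -(@eqn_pmul2l (2 ^ (2 * m))) ?expn_gt0 // -hnu e Dk expnMn mulnC.
  by rewrite -expnM (mulnC m).
have no_sqrt q n t : prime q -> q = 2%N \/ fermat_prime q /\ (3 < q)%N ->
    tower R nu n.+1 t -> t ^+ 2 = q%:R -> False.
  move=> pq hq Kt et; have [k [e|e]] := tower_sqrt nu_nsq (prime_gt0 pq) Kt et.
    by apply: (@prime_mul_nsquare q 1 k); rewrite ?muln1 ?logn1.
  apply: (@prime_mul_nsquare q nu k) => //.
  rewrite hnu lognM ?expn_gt0 // lognX oddD mul2n.
  case: hq => [->|[fq q3]].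
    rewrite logn_prime // eqxx muln1 odd_double /=.
    by rewrite lognE /= mu0 dvdn2 hodd.
  rewrite logn_prime // gtn_eqF ?(ltn_trans _ q3) // muln0 /=.
  rewrite lognE pq mu0 /=; case: ifP => // qmu.
  exfalso; apply: (hsq q fq q3); exists 0; rewrite expr0n /= mod0z.
  have /eqP -> : (mu%:Z %% q%:Z)%Z == 0 by rewrite -(sameP dvdz_mod0P eqP) dvdzE.
  by [].
move=> [_]; apply.
have [rs Drs] := closed_field_poly_normal ('X^12 - 1 : {poly R[i]}).
rewrite (monicP (monicXnsubC _ _)) // scale1r in Drs.
apply: (@sub_finite_set _ _ ((fun z : R[i] => complex.Re (z + z^-1) + 2) @` [set` rs])); last first.
  exact: finite_image (finite_seq rs).
move=> r [[n _ [Qr rint]] rb].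
have [z [w [zw zws [N pz]]]] := kronecker rint rb.
have Tr := Qadjoin_sub_tower Qr.
have hK := subfield_tower R nu n.+1.
have Kzw : exists2 s, tower R nu n.+1 s & z + w = s%:C.
  exists (r - 2) => //; apply: subfieldB => //; exact: subfield_nat.
have zwk k : z ^+ k * w ^+ k = 1 by rewrite -exprMn zw expr1n.
have Kzwk k : exists2 s, tower R nu n.+1 s & z ^+ k + w ^+ k = s%:C.
  by have [t Kt et] := power_sum_in hK zw Kzw k; exists t.
have [j totj] := totient_dvd_pow2 zw Kzw.
case: (dvd12_cases (prim_order_gt0 pz)) => [d12|d8|d9|[p [pp p3 dp]]].
- exists z => /=.
    rewrite /= -root_prod_XsubC -Drs rootE !hornerE subr_eq0.
    by rewrite -(prim_order_dvd pz).
  have -> : z^-1 = w.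
    have z0 : z != 0 by apply: contra_eq_neq zw => ->; rewrite mul0r eq_sym oner_eq0.
    by apply: (mulfI z0); rewrite mulfV.
  by rewrite zws /= subrK.
- have [t Kt et] := sqrt2_of_root8 hK (zwk _) (Kzwk _) (dvdn_prim_root pz d8).
  by exfalso; apply: (no_sqrt 2%N n t); rewrite //; left.
- have : (3 %| 2 ^ j)%N.
    by apply: dvdn_trans (totj _ _ (dvdn_prim_root pz d9)); rewrite (@totient_pfactor 3 2).
  by rewrite Euclid_dvdX.
have pz' := dvdn_prim_root pz dp.
have [] := @fermat_prime_of_pow2 p j pp p3.
  by rewrite -totient_prime //; exact: totj pz'.
move=> fp [i Dp]; rewrite Dp in pz'.
have [t Kt et] := sqrt_prime_of_root hK (zwk _) (Kzwk _) pz'.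
by exfalso; apply: (no_sqrt p n t) => //; [right | rewrite et -Dp].
Qed.

Lemma A_set_upward (R : realType) (S : set R) (t u : \bar R) : (t <= u)%E -> A_set S t -> A_set S u.
Proof.
move=> tu [tN inf]; split.
  by apply: contra_neq tN => uN; move: tu; rewrite uN leeNy_eq => /eqP.
apply: sub_infinite_set inf => r [Sr rt]; split=> // z /rt[s [-> /andP[s0 st]]].
by exists s; rewrite s0 (lt_le_trans st tu).
Qed.

Theorem theorem1p2 (R : realType) (m mu nu : nat)
    (hm : (1 <= m)%N) (hmu : (3 <= mu)%N) (hodd : odd mu)
    (hsq : forall p : nat, fermat_prime p -> (3 < p)%N -> ~ square_mod p mu)
    (hnu : nu = (2 ^ (2 * m) * mu)%N) :
  ((4%:R%:E < JR (O_tower R nu) < +oo)%E) \/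
  (JR (O_tower R nu) = 4%:R%:E /\ ~ A_set (O_tower R nu) 4%:R%:E).
Proof.
have nA := A_set_not4 (R := R) hodd hsq hnu.
have nu2 : (2 <= nu)%N.
  by rewrite hnu (leq_trans (ltnW hmu)) // leq_pmull // expn_gt0.
have : (4%:R%:E <= JR (O_tower R nu))%E.
  apply: le_ereal_inf_tmp => t At; rewrite leNgt; apply/negP => t4.
  by apply: nA; apply: A_set_upward At; exact: ltW.
rewrite le_eqVlt => /predU1P[<-|lt4]; [by right | left].
by rewrite lt4 JR_lty.
Qed.
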